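(* For every $\epsilon>0$ let $N=N(\epsilon)=10^{20}\epsilon^{-16\epsilon^{-1}}$. Let $n\geq N$ be an integer and let $G$ be a bipartite graph which is the union of $n$ pairwise edge-disjoint matchings $M_1,\dots,M_n$, each with at least $(1+\epsilon)n$ edges. Then $G$ contains a rainbow matching with $n$ edges.
   Context: The matchings $M_1,\dots,M_n$ are regarded as colour classes: each edge of $G$ lies in exactly one $M_i$ and receives colour $i$. A matching in $G$ is rainbow if no two of its edges have the same colour, i.e. it contains at most one edge from each $M_i$ (so a rainbow matching with $n$ edges contains exactly one edge of each $M_i$). *)

(* Defs.v *)
From mathcomp Require Import all_boot.
From Stdlib Require Export Reals.
Set Implicit Arguments. Unset Strict Implicit. Unset Printing Implicit Defensive.

(* A bipartite graph with parts X and Y: its edges are pairs (x, y) in X * Y. *)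

Definition is_matching (X Y : finType) (S : {set X * Y}) : Prop :=
  forall e f, e \in S -> f \in S -> e != f -> (e.1 != f.1) && (e.2 != f.2).

Definition union_graph (X Y : finType) (n : nat) (M : 'I_n -> {set X * Y}) : {set X * Y} :=
  \bigcup_(i < n) M i.

Definition rainbow_matching (X Y : finType) (n : nat) (M : 'I_n -> {set X * Y})
  (R : {set X * Y}) : Prop :=
  R \subset union_graph M /\ is_matching R /\ (forall i : 'I_n, #|R :&: M i| <= 1).

Definition N_eps (eps : R) : R := (10 ^ 20 * Rpower eps (- (16 / eps)))%R.

(* Main.v *)
(** A random set S of vertices of small density, chosen on X and then on Y,
    contains at least s >= 2 sqrt(n) edges of every matching and leaves at least
    n edges of every matching disjoint from S.  Outside S, Woolbright's switching
    argument gives a rainbow matching that misses k colours with k^2 <= n: if f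
    misses k colours, spending the missing colours one at a time enlarges by k at
    each step the set of colours that can be switched off, unless f can be
    augmented, so k^2 > n is impossible for a maximal f.  The missing colours are
    then matched greedily inside S, where each has at least 2k edges. *)
From mathcomp Require Import zify.
From Stdlib Require Import Reals ZArith Lra.
Require Import Defs.
From mathcomp Require Import all_boot.
Set Implicit Arguments. Unset Strict Implicit. Unset Printing Implicit Defensive.
(* mathcomp-zify binds the key R to ring_scope. *)
Local Delimit Scope R_scope with R.

(** * Bernoulli-type inequalities for powers of integers *)

Lemma leq_expl a b e : a <= b -> a ^ e <= b ^ e.
Proof. by case: e => // e; rewrite leq_exp2r. Qed.

Lemma bernoulli_succ p k : (p + k) * p ^ k <= p * p.+1 ^ k.
Proof.
elim: k => [|k IHk]; first by rewrite addn0 !expn0.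
rewrite !expnS; have := leq_mul IHk (leqnn p.+1); nia.
Qed.

Lemma bernoulli_pred m k : m.+1 ^ k * (m.+1 - k) <= m ^ k * m.+1.
Proof.
elim: k => [|k IHk]; first by rewrite subn0 !expn0.
have [le_km|lt_mk] := leqP k m; last by rewrite (_ : m.+1 - k.+1 = 0) ?muln0 //; lia.
rewrite !expnS; have := leq_mul IHk (leqnn m).
have : m.+1 * (m.+1 - k.+1) <= (m.+1 - k) * m by nia.
move: (m.+1 ^ k) (m ^ k) => a b H1 H2.
have : a * (m.+1 * (m.+1 - k.+1)) <= a * ((m.+1 - k) * m) by rewrite leq_mul.
nia.
Qed.

(** Bernoulli gives [(1 + 1/p)^p >= 2]; each of [j] blocks of [p] factors contributes one factor
    2. *)
Lemma exp2_mul_expn_le p j a : 0 < p -> j * p <= a -> 2 ^ j * p ^ a <= p.+1 ^ a.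
Proof.
move=> p0 /subnK <-; rewrite addnC !expnD mulnA leq_mul ?leq_expl //.
rewrite [j * p]mulnC !expnM -expnMn leq_expl // -(leq_pmul2l p0).
by have := bernoulli_succ p p; nia.
Qed.

(** Bernoulli for [1 - 1/(m+1)] gives [(1 + 1/m)^k <= 2] once [2k <= m+1]; this is raised to the
    power [v]. *)
Lemma expn_succ_le m k v b :
  0 < k -> k.*2 <= m.+1 -> b <= k * v -> m.+1 ^ b <= 2 ^ v * m ^ b.
Proof.
move=> k0 km bkv; have m0 : 0 < m by lia.
have step : m.+1 ^ k <= 2 * m ^ k.
  have := bernoulli_pred m k; have : m.+1 <= 2 * (m.+1 - k) by lia.
  move: (m.+1 ^ k) (m ^ k) (m.+1 - k) => x y z H1 H2.
  by rewrite -(leq_pmul2r (ltn0Sn m)); nia.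
have : m.+1 ^ (k * v) <= 2 ^ v * m ^ (k * v) by rewrite !expnM -expnMn leq_expl.
rewrite -(subnK bkv) !expnD.
have : m ^ (k * v - b) <= m.+1 ^ (k * v - b) by rewrite leq_expl.
have : 0 < m ^ (k * v - b) by rewrite expn_gt0 m0.
move: (m ^ _) (m.+1 ^ (_ - _)) (m ^ b) (m.+1 ^ b) => x y z t x0 xy H.
rewrite -(leq_pmul2l x0); apply: leq_trans (_ : y * t <= _); first by rewrite leq_mul2r xy orbT.
by rewrite (leq_trans H) // mulnCA.
Qed.

(** * Tail bounds for a random set of vertices, by counting *)

Section Sampling.
Variables (V : finType) (m : nat).
Implicit Types (h : {ffun V -> 'I_m.+1}) (A B : {set V}).

(** For uniform [h] this set contains each vertex independently with probability [1/(m+1)], so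
    counting functions replaces probability. *)
Definition fiber0 h := [set v | h v == ord0].

(** The generating function of the sample, scaled by [(m+1)^#|V|]: the sum factors over vertices,
    with a factor [a + m * b] on [A] and [m+1] elsewhere. *)
Lemma sum_weight_fiber0 A a b :
  \sum_(h : {ffun V -> 'I_m.+1}) a ^ #|A :&: fiber0 h| * b ^ #|A :\: fiber0 h|
  = (a + m * b) ^ #|A| * m.+1 ^ (#|V| - #|A|).
Proof.
pose F v (c : 'I_m.+1) := if v \in A then if c == ord0 then a else b else 1.
transitivity (\sum_(h : {ffun V -> 'I_m.+1}) \prod_v F v (h v)).
  apply: eq_bigr => h _.
  rewrite [RHS](bigID (mem A)) /= [X in _ = _ * X]big1 ?muln1; last first.
    by move=> v; rewrite /F => /negPf ->.
  rewrite [RHS](bigID (fun v => h v == ord0)) /=.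
  rewrite [X in _ = X * _](eq_bigr (fun=> a)); last first.
    by move=> v /andP[vA h0]; rewrite /F vA h0.
  rewrite [X in _ = _ * X](eq_bigr (fun=> b)); last first.
    by move=> v /andP[vA /negPf h0]; rewrite /F vA h0.
  rewrite !prod_nat_const; congr (_ ^ _ * _ ^ _); apply: eq_card => v; rewrite !inE //.
  by rewrite andbC.
rewrite -bigA_distr_bigA /= (bigID (mem A)) /=.
rewrite (eq_bigr (fun=> a + m * b)); last first.
  move=> v vA; rewrite big_ord_recl /F vA /=; congr (_ + _).
  by rewrite (eq_bigr (fun=> b)) // sum_nat_const card_ord.
rewrite [X in _ * X](eq_bigr (fun=> m.+1)); last first.
  by move=> v /negPf vA; rewrite /F vA sum1_card card_ord.
rewrite !prod_nat_const; congr (_ * _ ^ _).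
rewrite -cardsT -cardsDS ?subsetT //; apply: eq_card => v; by rewrite !inE andbT.
Qed.

(** Lower Chernoff tail: Markov's inequality for the weight [2 ^ #|A :\: fiber0 h|], that is,
    [a = 1] and [b = 2]. *)
Lemma card_few_fiber0 A t s : (t + s) * m.*2.+1 <= #|A| ->
  #|[set h : {ffun V -> 'I_m.+1} | #|A :&: fiber0 h| < t]| * 2 ^ s <= m.+1 ^ #|V|.
Proof.
move=> hA; have tA : t <= #|A| by nia.
set bad := [set h | _].
have sum_ge : #|bad| * 2 ^ (#|A| - t) <= m.*2.+1 ^ #|A| * m.+1 ^ (#|V| - #|A|).
  rewrite -[m.*2.+1]/(1 + m.*2) -muln2 -sum_weight_fiber0 -sum_nat_const.
  rewrite [leqRHS](bigID (mem bad)) /= (leq_trans _ (leq_addr _ _)) // leq_sum // => h.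
  by rewrite inE => hh; rewrite exp1n mul1n leq_exp2l // cardsD; lia.
(* The gain [2^(t+s)] of [(2m+2)^#|A|] over [(2m+1)^#|A|] pays [2^t] for the threshold and leaves
   [2^s]. *)
have := exp2_mul_expn_le (ltn0Sn _) hA.
rewrite -doubleS -[m.+1.*2]muln2 expnMn => exp_le.
rewrite -(leq_pmul2l (m := 2 ^ #|A|)) ?expn_gt0 //.
apply: leq_trans (_ : 2 ^ (t + s) * (m.*2.+1 ^ #|A| * m.+1 ^ (#|V| - #|A|)) <= _).
  rewrite -{1}(subnK tA) !expnD; apply: leq_trans (_ : 2 ^ t * 2 ^ s * (#|bad| * 2 ^ (#|A| - t)) <= _).
    by apply: eq_leq; nia.
  by rewrite leq_mul.
rewrite mulnA; apply: leq_trans (_ : (m.+1 ^ #|A| * 2 ^ #|A|) * m.+1 ^ (#|V| - #|A|) <= _).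
  by rewrite leq_mul.
by rewrite mulnC mulnA -expnD subnK ?max_card // mulnC.
Qed.

(** Upper tail: Markov's inequality for [2 ^ #|B :&: fiber0 h|], whose mean [((m+2)/(m+1))^#|B|] is
    at most [2^v]. *)
Lemma card_many_fiber0 B k v s : 0 < k -> k.*2 <= m.+2 -> #|B| <= k * v ->
  #|[set h : {ffun V -> 'I_m.+1} | v + s < #|B :&: fiber0 h|]| * 2 ^ s <= m.+1 ^ #|V|.
Proof.
move=> k0 km hB; set bad := [set h | _].
have sum_ge : #|bad| * 2 ^ (v + s) <= m.+2 ^ #|B| * m.+1 ^ (#|V| - #|B|).
  have -> : m.+2 = 2 + m * 1 by rewrite muln1.
  rewrite -sum_weight_fiber0 -sum_nat_const.
  rewrite [leqRHS](bigID (mem bad)) /= (leq_trans _ (leq_addr _ _)) // leq_sum // => h.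
  by rewrite inE => hh; rewrite exp1n muln1 leq_exp2l // ltnW.
have exp_le := expn_succ_le k0 km hB.
rewrite -(leq_pmul2l (m := 2 ^ v)) ?expn_gt0 // mulnCA -expnD.
apply: leq_trans sum_ge _.
apply: leq_trans (_ : 2 ^ v * m.+1 ^ #|B| * m.+1 ^ (#|V| - #|B|) <= _); first by rewrite leq_mul.
by rewrite -mulnA -expnD subnKC ?max_card.
Qed.

End Sampling.

(** Union bound over [2 * #|I|] bad events, each of probability at most [2^-s]. *)
Lemma exists_sample (V I : finType) (A B : I -> {set V}) k t v s :
  0 < k -> 2 * #|I| < 2 ^ s ->
  (forall i, (t + s) * (4 * k) <= #|A i|) -> (forall i, #|B i| <= k * v) ->
  exists S : {set V}, forall i, t <= #|A i :&: S| /\ #|B i :&: S| <= v + s.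
Proof.
(* With [k] now lowered by one, the density is [1/(2k+1)]; both tail bounds apply, as
   [2m+1 <= 4(k+1)] and [2(k+1) <= m+2]. *)
case: k => // k _ hs hA hB; pose m := k.*2.
pose low i := [set h : {ffun V -> 'I_m.+1} | #|A i :&: fiber0 h| < t].
pose high i := [set h : {ffun V -> 'I_m.+1} | v + s < #|B i :&: fiber0 h|].
pose bad := \bigcup_i (low i :|: high i).
have lowP i : #|low i| * 2 ^ s <= m.+1 ^ #|V|.
  by apply: card_few_fiber0; have := hA i; rewrite /m; nia.
have highP i : #|high i| * 2 ^ s <= m.+1 ^ #|V|.
  by apply: (@card_many_fiber0 V m (B i) k.+1) => //; rewrite doubleS.
have lt_bad : #|bad| * 2 ^ s < m.+1 ^ #|V| * 2 ^ s.
  apply: leq_ltn_trans (_ : \sum_(i : I) 2 * m.+1 ^ #|V| < _).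
    apply: leq_trans (_ : (\sum_i #|low i :|: high i|) * 2 ^ s <= _).
      rewrite leq_mul2r; apply/orP; right; rewrite /bad.
      elim/big_rec2: _ => [|i b S _ le_Sb]; first by rewrite cards0.
      by rewrite (leq_trans (leq_card_setU _ _)) ?leq_add2l.
    rewrite big_distrl leq_sum //= => i _.
    rewrite mul2n -addnn (leq_trans _ (leq_add (lowP i) (highP i))) //.
    by rewrite -mulnDl leq_mul2r leq_card_setU orbT.
  by rewrite sum_nat_const mulnA mulnC ltn_pmul2l ?expn_gt0 // mulnC.
rewrite ltn_pmul2r ?expn_gt0 // in lt_bad.
have /existsP[h hbad] : [exists h, h \notin bad].
  apply: contraTT lt_bad => /existsPn all_bad; rewrite -leqNgt.
  rewrite -[X in X ^ _]card_ord -card_ffun subset_leq_card //.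
  by apply/subsetP=> h _; apply/negPn/all_bad.
exists (fiber0 h) => i.
have : h \notin low i :|: high i by apply: contra hbad => hi; apply/bigcupP; exists i.
by rewrite !inE negb_or -!leqNgt => /andP.
Qed.

(** * Matchings and their projections to the two sides *)

Lemma eq_fst_matching (X Y : finType) (S : {set X * Y}) e f :
  is_matching S -> e \in S -> f \in S -> e.1 = f.1 -> e = f.
Proof.
move=> mS eS fS ef; apply/eqP; apply: contraT => /(mS _ _ eS fS)/andP[].
by rewrite ef eqxx.
Qed.

Lemma eq_snd_matching (X Y : finType) (S : {set X * Y}) e f :
  is_matching S -> e \in S -> f \in S -> e.2 = f.2 -> e = f.
Proof.
move=> mS eS fS ef; apply/eqP; apply: contraT => /(mS _ _ eS fS)/andP[_].
by rewrite ef eqxx.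
Qed.

Lemma is_matchingS (X Y : finType) (S T : {set X * Y}) :
  S \subset T -> is_matching T -> is_matching S.
Proof. by move=> /subsetP sub mT e f /sub eT /sub fT; apply: mT. Qed.

Lemma card_matching_fst (X Y : finType) (S : {set X * Y}) (P : pred X) :
  is_matching S -> #|[set e in S | P e.1]| = #|[set x in fst @: S | P x]|.
Proof.
move=> mS; rewrite -(@card_in_imset _ _ fst); last first.
  by move=> e f; rewrite !inE => /andP[eS _] /andP[fS _]; apply: eq_fst_matching mS eS fS.
apply: eq_card => x; rewrite inE; apply/imsetP/andP.
  by case=> e; rewrite inE => /andP[eS Pe] ->; split=> //; apply: imset_f.
by case=> /imsetP[e eS ->] Pe; exists e; rewrite // inE eS.
Qed.

Lemma card_matching_snd (X Y : finType) (S : {set X * Y}) (P : pred Y) :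
  is_matching S -> #|[set e in S | P e.2]| = #|[set y in snd @: S | P y]|.
Proof.
move=> mS; rewrite -(@card_in_imset _ _ snd); last first.
  by move=> e f; rewrite !inE => /andP[eS _] /andP[fS _]; apply: eq_snd_matching mS eS fS.
apply: eq_card => x; rewrite inE; apply/imsetP/andP.
  by case=> e; rewrite inE => /andP[eS Pe] ->; split=> //; apply: imset_f.
by case=> /imsetP[e eS ->] Pe; exists e; rewrite // inE eS.
Qed.

(** * Partial rainbow matchings: greedy completion and Woolbright switching *)

Section PartialRainbow.
Variables (X Y I : finType) (M : I -> {set X * Y}).
Implicit Types (f g : {ffun I -> option (X * Y)}).

(* A rainbow matching, recorded as the partial choice of an edge of each colour. *)
Definition partial_rainbow f :=
  (forall i e, f i = Some e -> e \in M i) /\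
  (forall i j e e', f i = Some e -> f j = Some e' -> i != j ->
     (e.1 != e'.1) && (e.2 != e'.2)).

Definition missing f := [set i | f i == None].

Definition set_colour f c e : {ffun I -> option (X * Y)} :=
  [ffun i => if i == c then Some e else f i].

Lemma partial_rainbow_set f c e :
  partial_rainbow f -> e \in M c ->
  (forall i e', f i = Some e' -> (e'.1 != e.1) && (e'.2 != e.2)) ->
  partial_rainbow (set_colour f c e).
Proof.
case=> f_in f_dis eM e_free; split=> [i e'|i j e1 e2]; rewrite !ffunE.
  by case: eqP => [-> [<-]|_ /f_in].
case: eqP => [->|_]; case: eqP => [->|_].
- by rewrite eqxx.
- by move=> [<-] /e_free; rewrite eq_sym [_.2 == _]eq_sym.
- by move=> /e_free H [<-].
- exact: f_dis.
Qed.

Lemma missing_set f c e : missing (set_colour f c e) = missing f :\ c.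
Proof. by apply/setP=> i; rewrite !inE ffunE; case: (i == c). Qed.

Lemma card_missing_set f c e : c \in missing f ->
  #|missing (set_colour f c e)| < #|missing f|.
Proof. by move=> cm; rewrite missing_set [leqRHS](cardsD1 c) cm. Qed.

Definition unset_colour f c : {ffun I -> option (X * Y)} :=
  [ffun i => if i == c then None else f i].

Lemma partial_rainbow_unset f c :
  partial_rainbow f -> partial_rainbow (unset_colour f c).
Proof.
case=> f_in f_dis; split=> [i e'|i j e1 e2]; rewrite !ffunE.
  by case: ifP => // _ /f_in.
by case: ifP => // _; case: ifP => // _; apply: f_dis.
Qed.

Lemma missing_unset f c : missing (unset_colour f c) = c |: missing f.
Proof. by apply/setP=> i; rewrite !inE ffunE; case: (i == c). Qed.

Definition free_vertices f e :=
  [forall i, if f i is Some e' then (e'.1 != e.1) && (e'.2 != e.2) else true].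

Lemma free_verticesP f e :
  reflect (forall i e', f i = Some e' -> (e'.1 != e.1) && (e'.2 != e.2))
          (free_vertices f e).
Proof.
apply: (iffP forallP) => [H i e' fi|H i]; first by have := H i; rewrite fi.
by case E: (f i) => [e'|//]; apply: H E.
Qed.

(** An added edge meets at most two edges of any other matching, one at each end, so both sides of
    the hypothesis drop by at most 2 per colour and it persists. *)
Lemma greedy_completion f :
  (forall i, is_matching (M i)) -> partial_rainbow f ->
  (forall i, i \in missing f ->
     2 * #|missing f| <= #|[set e in M i | free_vertices f e]|) ->
  exists g, partial_rainbow g /\ missing g = set0.
Proof.
move=> mM; move Ek: #|missing f| => k; elim: k f Ek => [|k IHk] f Ek rf many.
  by exists f; split=> //; apply/eqP; rewrite -cards_eq0 Ek.
have /card_gt0P[c cm] : 0 < #|missing f| by rewrite Ek.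
have /card_gt0P[e] : 0 < #|[set e in M c | free_vertices f e]|.
  by apply: leq_trans (many c cm); lia.
rewrite inE => /andP[eM /free_verticesP e_free].
have rg : partial_rainbow (set_colour f c e) by apply: partial_rainbow_set.
apply: (IHk _ _ rg); first by move: Ek; rewrite missing_set (cardsD1 c) cm => -[].
move=> i; rewrite missing_set inE => /andP[ic im].
have := many i im; set F := [set e in M i | _]; set G := [set e in M i | _].
suff : #|F| <= #|G| + 2 by lia.
have sub : F \subset G :|: ([set e' in M i | e'.1 == e.1] :|: [set e' in M i | e'.2 == e.2]).
  apply/subsetP=> e'; rewrite !inE => /andP[e'M /free_verticesP e'_free]; rewrite e'M /=.
  case: eqVneq => [|ne1]; rewrite ?orbT //; case: eqVneq => [|ne2]; rewrite ?orbT // !orbF.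
  apply/free_verticesP => j e1; rewrite ffunE; case: ifP => [_ [<-]|_ /e'_free //].
  by rewrite eq_sym ne1 eq_sym ne2.
apply: leq_trans (subset_leq_card sub) _; apply: leq_trans (leq_card_setU _ _) _.
rewrite leq_add2l; apply: leq_trans (leq_card_setU _ _) _; rewrite -[2]/(1 + 1).
have card1 (P : pred (X * Y)) : (forall e1 e2, e1 \in M i -> e2 \in M i -> P e1 -> P e2 -> e1 = e2) ->
    #|[set e' in M i | P e']| <= 1.
  move=> H; apply/card_le1_eqP => e1 e2; rewrite !inE => /andP[? ?] /andP[? ?]; exact: H.
apply: leq_add; apply: card1 => e1 e2 e1M e2M /eqP eq1 /eqP eq2.
  by apply: (eq_fst_matching (mM i)) => //; rewrite eq1.
by apply: (eq_snd_matching (mM i)) => //; rewrite eq1.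
Qed.

(* [C] is the set of missing colours spent so far; each vertex of X that is
   unused by [f] or used only by a colour of [D] can be left uncovered by a
   rainbow matching that agrees with [f] outside [D], has the same size as [f],
   and covers no new vertex of Y. *)
Definition switchable f (C D : {set I}) :=
  forall x, (forall i e, f i = Some e -> e.1 = x -> i \in D) ->
  exists g, [/\ partial_rainbow g /\ #|missing g| = #|missing f|,
    forall i e, g i = Some e -> e.1 != x,
    forall i e, g i = Some e -> exists j e', f j = Some e' /\ e'.2 = e.2,
    forall i, i \notin missing f -> i \notin D -> g i = f i &
    forall i, i \in missing f -> i \notin C -> g i = None].

(** Colour [c] is spent: an edge of [M c] whose X-end can be freed either augments [f] or makes the
    colour at its Y-end switchable. *)
Lemma switchable_step f (C D : {set I}) c :
  (forall i, is_matching (M i)) -> #|I| <= #|M c| -> partial_rainbow f ->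
  c \in missing f -> c \notin C -> D \subset ~: missing f -> switchable f C D ->
  (exists g, partial_rainbow g /\ #|missing g| < #|missing f|) \/
  exists D' : {set I}, [/\ D' \subset ~: missing f, #|missing f| + #|D| <= #|D'| &
                 switchable f (c |: C) D'].
Proof.
move=> mM cardM rf cm cC Dm sw.
(* The unblocked vertices are those that [switchable] can leave uncovered. *)
pose blocked x := [exists i, (i \notin D) && (if f i is Some e then e.1 == x else false)].
have blockedP x : reflect (forall i e, f i = Some e -> e.1 = x -> i \in D) (~~ blocked x).
  apply: (iffP existsPn) => [H i e fi ex|H i].
    by have := H i; rewrite fi ex eqxx andbT negbK.
  case E: (f i) => [e|]; last by rewrite andbF.
  by case: eqP => [/(H _ _ E) ->|_]; rewrite ?andbF.
pose E := [set e in M c | ~~ blocked e.1].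
(* Blocked vertices number at most [#|I| - #|missing f| - #|D|], one per used colour outside [D],
   while [M c] has at least [#|I|] edges. *)
have cardE : #|missing f| + #|D| <= #|E|.
  have le_blocked : #|[set e in M c | blocked e.1]| <= #|~: missing f :\: D|.
    rewrite card_matching_fst //.
    rewrite -(card_imset _ (@Some_inj _)).
    apply: leq_trans (leq_imset_card (fun i => omap fst (f i)) _).
    apply/subset_leq_card/subsetP => ox /imsetP[x].
    rewrite inE => /andP[_ /existsP[i /andP[iD]]]; case fi: (f i) => [e|//] /eqP ex ->.
    by apply/imsetP; exists i; [rewrite !inE iD fi | rewrite fi /= ex].
  have := cardsID [set e in M c | blocked e.1] (M c).
  have -> : M c :&: [set e in M c | blocked e.1] = [set e in M c | blocked e.1].
    by apply/setP => e; rewrite !inE andbA andbb.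
  have -> : M c :\: [set e in M c | blocked e.1] = E.
    by apply/setP => e; rewrite !inE; case: (e \in M c); rewrite ?andbF ?andbT.
  have := cardsC (missing f); have := cardsID D (~: missing f).
  rewrite (setIidPr Dm); lia.
pose covered y := [exists i, if f i is Some e then e.2 == y else false].
(* If the Y-end of some [e] in [E] is uncovered by [f], freeing the X-end does not cover it, so [e]
   can be added in colour [c]. *)
have [/existsP[e /andP[]]|/existsPn E_covered] := boolP [exists e, (e \in E) && ~~ covered e.2].
  rewrite inE => /andP[eM /blockedP /sw[g [[rg <-] g1 g2 _ gc]]] /existsPn unc; left.
  exists (set_colour g c e); split; last first.
    by rewrite card_missing_set // inE gc.
  apply: partial_rainbow_set => // i e' gi; rewrite (g1 _ _ gi) /=.
  have [j [e1 [fj <-]]] := g2 _ _ gi; by have := unc j; rewrite fj.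
(* Otherwise the edges of [E] meet distinct colours of [f] at their Y-ends, so [hit] has at least
   [#|E|] elements. *)
right; pose hit := [set i | [exists e in E, if f i is Some e' then e'.2 == e.2 else false]].
have hit_sub : hit \subset ~: missing f.
  by apply/subsetP => i; rewrite !inE => /existsP[e /andP[_]]; case: (f i).
exists (D :|: hit); split.
- by rewrite subUset Dm.
- apply: leq_trans cardE _; apply: leq_trans (_ : #|hit| <= _); last first.
    by rewrite subset_leq_card // subsetUr.
  rewrite -(@card_in_imset _ _ (fun e => Some e.2)); last first.
    move=> e e'; rewrite !inE => /andP[eM _] /andP[e'M _] [].
    exact: (eq_snd_matching (mM c)).
  apply: leq_trans (leq_imset_card (fun i => omap snd (f i)) _).
  apply/subset_leq_card/subsetP => oy /imsetP[e eE ->].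
  have := E_covered e; rewrite eE negbK => /existsP[i].
  case fi: (f i) => [e'|//] /eqP e'e.
  apply/imsetP; exists i; last by rewrite fi /= e'e.
  by rewrite inE; apply/existsP; exists e; rewrite eE fi e'e /=.
move=> x xD'.
have [/blockedP /sw|] := boolP (~~ blocked x).
  move=> [g [rg g1 g2 g3 g4]]; exists g; split=> // i im.
    by rewrite !inE negb_or => /andP[iD _]; apply: g3.
  by rewrite !inE negb_or => /andP[_ iC]; apply: g4.
rewrite negbK => /existsP[i /andP[iD]]; case fi: (f i) => [ex|//] /eqP exx.
have : i \in D :|: hit by apply: xD' fi exx.
rewrite !inE (negPf iD) fi => /existsP[e /andP[]].
rewrite inE => /andP[eM eb] /eqP ey.
have [g [[[g_in g_dis] gcard] g1 g2 g3 g4]] := sw _ (elimT (blockedP _) eb).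
have im : i \notin missing f by rewrite inE fi.
have gi : g i = Some ex by rewrite g3.
have gc : g c = None by rewrite g4.
have ic : i != c by apply/eqP => ic; rewrite ic gc in gi.
(* The swap: colour [i] drops its edge, freeing [x], and [c] takes [e], which reuses the released
   Y-vertex; the size is unchanged. *)
exists (set_colour (unset_colour g i) c e); split.
- split.
    apply: partial_rainbow_set => // [|j e']; first by apply: partial_rainbow_unset.
    rewrite ffunE; case: ifP => // ji gj; rewrite (g1 _ _ gj) /= -ey.
    by have /andP[] := g_dis _ _ _ _ gj gi (negbT ji).
  rewrite missing_set missing_unset -gcard.
  have : c \in i |: missing g by rewrite !inE gc orbT.
  have : i \notin missing g by rewrite inE gi.
  by move=> ni cU; have := cardsD1 c (i |: missing g); rewrite cU cardsU1 ni add1n => -[].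
- move=> j e'; rewrite !ffunE; case: ifP => [_ [<-]|_].
    apply: contraNneq iD => e1x.
    by apply: (elimT (blockedP _) eb) fi _; rewrite exx.
  case: ifP => // ji gj; rewrite -exx.
  by have /andP[] := g_dis _ _ _ _ gj gi (negbT ji).
- move=> j e'; rewrite !ffunE; case: ifP => [_ [<-]|_]; first by exists i, ex.
  by case: ifP => // _; apply: g2.
- move=> j jm; rewrite inE negb_or => /andP[jD jhit]; rewrite !ffunE.
  case: eqP jm => [-> |_ jm]; first by rewrite cm.
  case: eqP jhit => [->|_ _]; last exact: g3.
  case/negP; rewrite inE fi; apply/existsP; exists e; by rewrite inE eM eb ey eqxx.
move=> j jm; rewrite inE negb_or inE => /andP[jc jC]; rewrite !ffunE (negPf jc).
by case: ifP => // _; apply: g4.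
Qed.

Lemma rainbow_augment f :
  (forall i, is_matching (M i)) -> (forall i, #|I| <= #|M i|) -> partial_rainbow f ->
  #|I| < #|missing f| ^ 2 ->
  exists g, partial_rainbow g /\ #|missing g| < #|missing f|.
Proof.
move=> mM cardM rf big.
have claim j : j <= #|missing f| ->
  (exists g, partial_rainbow g /\ #|missing g| < #|missing f|) \/
  exists C D : {set I}, [/\ C \subset missing f, #|C| = j, D \subset ~: missing f,
    j * #|missing f| <= #|D| & switchable f C D].
  elim: j => [_|j IHj jk].
    right; exists set0, set0; rewrite !sub0set !cards0; split=> // x xf.
    exists f; split=> //.
    - by move=> i e fi; apply/eqP => /(xf _ _ fi); rewrite inE.
    - by move=> i e fi; exists i, e.
    by move=> i; rewrite inE => /eqP.
  case: (IHj (ltnW jk)) => [|[C [D [Cm Cj Dm Dj sw]]]]; first by left.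
  have /card_gt0P[c] : 0 < #|missing f :\: C|.
    by rewrite cardsDS // Cj subn_gt0.
  rewrite inE => /andP[cC cm].
  case: (switchable_step mM (cardM c) rf cm cC Dm sw) => [|[D' [D'm D'j sw']]]; first by left.
  right; exists (c |: C), D'; split=> //.
  - by rewrite subUset sub1set cm.
  - by rewrite cardsU1 cC Cj.
  by rewrite mulSn; apply: leq_trans D'j; rewrite leq_add2l.
case: (claim _ (leqnn _)) => // -[C [D [_ _ _ cardD _]]].
by have := leq_trans cardD (max_card _); rewrite leqNgt mulnn big.
Qed.

Lemma rainbow_sqrt :
  (forall i, is_matching (M i)) -> (forall i, #|I| <= #|M i|) ->
  exists f, partial_rainbow f /\ #|missing f| ^ 2 <= #|I|.
Proof.
move=> mM cardM.
suff H k f : #|missing f| <= k -> partial_rainbow f ->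
    exists g, partial_rainbow g /\ #|missing g| ^ 2 <= #|I|.
  by apply: (H _ [ffun=> None] (leqnn _)); split=> [i e|i j e e']; rewrite !ffunE.
elim: k f => [|k IHk] f le_k rf.
  by exists f; split=> //; move: le_k; rewrite leqn0 => /eqP ->.
have [le|/(rainbow_augment mM cardM rf)[g [rg lt_g]]] := leqP (#|missing f| ^ 2) #|I|.
  by exists f.
by apply: IHk rg; rewrite -ltnS (leq_trans lt_g).
Qed.

End PartialRainbow.

(** * The reserve inside a vertex sample, and its use *)

Lemma card_inside_outside (X Y : finType) (S : {set X * Y}) (A : {set X}) (B : {set Y}) :
  is_matching S ->
  #|S| <= #|[set e in S | (e.1 \notin A) && (e.2 \notin B)]|
          + (#|fst @: S :&: A| + #|snd @: S :&: B|).
Proof.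
move=> mS; have -> : fst @: S :&: A = [set x in fst @: S | x \in A].
  by apply/setP => x; rewrite !inE.
have -> : snd @: S :&: B = [set y in snd @: S | y \in B] by apply/setP => y; rewrite !inE.
rewrite -(card_matching_fst (mem A)) // -(card_matching_snd (mem B)) //.
apply: leq_trans (_ : #|[set e in S | (e.1 \notin A) && (e.2 \notin B)]
   :|: ([set e in S | e.1 \in A] :|: [set e in S | e.2 \in B])| <= _).
  apply/subset_leq_card/subsetP => e eS; rewrite !inE eS /=.
  by case: (e.1 \in A); case: (e.2 \in B).
by rewrite (leq_trans (leq_card_setU _ _)) // leq_add2l leq_card_setU.
Qed.

Lemma exists_subset_card (T : finType) (A : {set T}) k :
  k <= #|A| -> exists2 B : {set T}, B \subset A & #|B| = k.
Proof.
move=> kA; exists [set x in take k (enum A)].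
  by apply/subsetP => x; rewrite inE => /mem_take; rewrite mem_enum.
rewrite cardsE; have /card_uniqP -> : uniq (take k (enum A)) by rewrite take_uniq ?enum_uniq.
by rewrite size_take -cardE; case: ltngtP kA.
Qed.

(** Two successive samples: [A] keeps [t1] edges of each colour, then [B] keeps [t2] of those. Each
    side meets at most [v + s] edges of a colour, hence the loss [2 * (v + s)]. *)
Lemma reserve_exists (X Y I : finType) (M : I -> {set X * Y}) k v s t1 t2 :
  0 < k -> 2 * #|I| < 2 ^ s -> (forall i, is_matching (M i)) ->
  (forall i, #|M i| <= k * v) -> (forall i, (t1 + s) * (4 * k) <= #|M i|) ->
  (t2 + s) * (4 * k) <= t1 ->
  exists (A : {set X}) (B : {set Y}), forall i,
    t2 <= #|[set e in M i | (e.1 \in A) && (e.2 \in B)]| /\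
    #|M i| <= #|[set e in M i | (e.1 \notin A) && (e.2 \notin B)]| + 2 * (v + s).
Proof.
move=> k0 hs mM hv h1 h2.
have card1 i : #|fst @: M i| = #|M i|.
  by apply: card_in_imset => e f; apply: eq_fst_matching.
have card2 i : #|snd @: M i| = #|M i|.
  by apply: card_in_imset => e f; apply: eq_snd_matching.
have [||A HA] := @exists_sample X I (fun i => fst @: M i) (fun i => fst @: M i) k t1 v s k0 hs.
- by move=> i; rewrite card1.
- by move=> i; rewrite card1.
pose MA i := [set e in M i | e.1 \in A].
have mMA i : is_matching (MA i).
  by apply: is_matchingS (mM i); apply/subsetP => e; rewrite inE => /andP[].
have cardMA i : t1 <= #|MA i|.
  rewrite /MA (card_matching_fst (mem A)) //; apply: leq_trans (proj1 (HA i)) _.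
  by apply: eq_leq; apply: eq_card => x; rewrite !inE.
have [||B HB] := @exists_sample Y I (fun i => snd @: MA i) (fun i => snd @: M i) k t2 v s k0 hs.
- move=> i; rewrite card_in_imset; first exact: leq_trans h2 (cardMA i).
  by move=> e f; apply: eq_snd_matching.
- by move=> i; rewrite card2.
exists A, B => i; have [_ HA2] := HA i; have [HB1 HB2] := HB i; split.
  apply: leq_trans HB1 _.
  have -> : snd @: MA i :&: B = [set y in snd @: MA i | y \in B].
    by apply/setP => y; rewrite !inE.
  rewrite -(card_matching_snd (mem B)) //; apply: eq_leq; apply: eq_card => e.
  by rewrite !inE andbA.
have := card_inside_outside A B (mM i); lia.
Qed.

(** A rainbow matching built outside the sample leaves every edge within [A] and [B] free for the
    greedy completion. *)
Lemma full_rainbow_of_reserve (X Y I : finType) (M : I -> {set X * Y})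
    (A : {set X}) (B : {set Y}) s :
  (forall i, is_matching (M i)) ->
  (forall i, s <= #|[set e in M i | (e.1 \in A) && (e.2 \in B)]|) ->
  (forall i, #|I| <= #|[set e in M i | (e.1 \notin A) && (e.2 \notin B)]|) ->
  (forall k, k ^ 2 <= #|I| -> 2 * k <= s) ->
  exists f : {ffun I -> option (X * Y)}, partial_rainbow M f /\ missing f = set0.
Proof.
move=> mM inside outside hs.
pose MO i := [set e in M i | (e.1 \notin A) && (e.2 \notin B)].
have sub i : MO i \subset M i by apply/subsetP => e; rewrite inE => /andP[].
have [|f [[f_in f_dis] f_card]] := @rainbow_sqrt X Y I MO _ outside.
  by move=> i; apply: is_matchingS (mM i).
apply: (@greedy_completion X Y I M f) => //.
  by split=> // i e /f_in; apply/subsetP/sub.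
move=> i _; apply: leq_trans (hs _ f_card) _; apply: leq_trans (inside i) _.
apply/subset_leq_card/subsetP => e; rewrite !inE => /and3P[-> eA eB] /=.
apply/free_verticesP => j e' /f_in; rewrite inE => /and3P[_ e'A e'B].
apply/andP; split; first by apply: contraNneq e'A => ->.
by apply: contraNneq e'B => ->.
Qed.

(** * Choice of the parameters in integers *)

Lemma double_sqr_le_exp s : (s.+1) ^ 2 <= 128 * 2 ^ s.
Proof.
elim: s => [|s IHs] //; case: s IHs => [|[|[|s]]] // IHs.
by rewrite [2 ^ _]expnS; nia.
Qed.

Lemma sqr_quotient_lt a w n q : 0 < w -> a * w ^ 2 <= n -> n < q * w -> a * n < q ^ 2.
Proof.
move=> w0 an nq; rewrite -(@ltn_pmul2r (w ^ 2)) ?expn_gt0 ?w0 // -expnMn mulnAC.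
by apply: leq_ltn_trans (_ : n ^ 2 < _); [rewrite -mulnn leq_mul | rewrite ltn_exp2r].
Qed.

Lemma nat_full_rainbow (X Y I : finType) (M : I -> {set X * Y}) K :
  0 < K -> 256 * (2 ^ 13 * K ^ 2) ^ 2 <= #|I| -> (forall i, is_matching (M i)) ->
  (forall i, #|M i| = #|I| + #|I| %/ K) ->
  exists f : {ffun I -> option (X * Y)}, partial_rainbow M f /\ missing f = set0.
Proof.
set n := #|I| => K0 hn mM hM.
(* Here [1/K] plays the role of epsilon, and [s] serves both as reserve size and as failure
   exponent. *)
pose s := n %/ (2 ^ 13 * K ^ 2).
have K2 : 0 < 2 ^ 13 * K ^ 2 by rewrite muln_gt0 !expn_gt0 K0.
have s_le : s * (2 ^ 13 * K ^ 2) <= n by apply: leq_divM.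
have lt_s : n < s.+1 * (2 ^ 13 * K ^ 2) by apply: ltn_ceil.
have sqr_lt : 256 * n < s.+1 ^ 2 := sqr_quotient_lt K2 hn lt_s.
have exp_s : 2 * n < 2 ^ s.
  by have := double_sqr_le_exp s; rewrite -(ltn_pmul2l (m := 128)) //; lia.
have n0 : 0 < n by apply: leq_trans hn; rewrite muln_gt0 expn_gt0 K2.
have s0 : 0 < s by case: (s) exp_s => //; rewrite expn0; lia.
clearbody s; set q := n %/ K.
have q_le : q * K <= n by apply: leq_divM.
have lt_q : n < q.+1 * K by apply: ltn_ceil.
have s_le' : s * (8192 * (K * K)) <= n by move: s_le; rewrite mulnn.
have qn : q <= n by nia.
have [A [B HAB]] : exists (A : {set X}) (B : {set Y}), forall i,
    s <= #|[set e in M i | (e.1 \in A) && (e.2 \in B)]| /\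
    #|M i| <= #|[set e in M i | (e.1 \notin A) && (e.2 \notin B)]| + 2 * ((q %/ 4 + 1) + s).
  (* The first sample must keep [(s + s) * (4 * 8K) = 64Ks] edges so that the second keeps [s]. *)
  apply: (@reserve_exists X Y I M (8 * K) _ s (64 * K * s) s) => //.
  - by rewrite muln_gt0.
  - move=> i; rewrite hM -/q; have : q < (q %/ 4).+1 * 4 by apply: ltn_ceil.
    nia.
  - by move=> i; rewrite hM -/q; nia.
  by nia.
apply: (@full_rainbow_of_reserve X Y I M A B s) => // [i|i|k kn].
- by have [] := HAB i.
(* The loss, at most [q/2 + 2 + 2s], fits into the surplus [q] because [s] is tiny against [q]. *)
- have [_] := HAB i; rewrite hM -/q.
  have : 100 * s <= q.
    have : s * 8192 * K <= n by nia.
    have : K <= n by nia.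
    nia.
  have : q %/ 4 * 4 <= q by apply: leq_divM.
  lia.
(* From [256 * n < (s+1)^2] follows [16k < s+1], more than enough for [2k <= s]. *)
have : k ^ 2 <= n by [].
by rewrite -mulnn; nia.
Qed.

(** Edge-disjointness ensures that an edge chosen for one colour lies in no other matching. *)
Lemma rainbow_of_partial (X Y : finType) n (M : 'I_n -> {set X * Y}) f :
  (forall i j : 'I_n, i != j -> [disjoint M i & M j]) ->
  partial_rainbow M f -> missing f = set0 ->
  exists Rm : {set X * Y}, rainbow_matching M Rm /\ #|Rm| = n.
Proof.
move=> hdisj [f_in f_dis] fT.
have some_f i : {e | f i = Some e}.
  case fi: (f i) => [e|]; first by exists e.
  by have : i \in missing f; [rewrite inE fi | rewrite fT inE].
pose g i := sval (some_f i); have gP i : f i = Some (g i) := svalP (some_f i).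
have g_inj : injective g.
  move=> i j gij; apply/eqP; apply: contraT => /(f_dis _ _ _ _ (gP i) (gP j)).
  by rewrite gij eqxx.
exists [set g i | i : 'I_n]; split; last by rewrite card_imset // card_ord.
split; [|split].
- by apply/subsetP => e /imsetP[i _ ->]; apply/bigcupP; exists i => //; apply: f_in.
- move=> e e' /imsetP[i _ ->] /imsetP[j _ ->] ne.
  by apply: f_dis (gP i) (gP j) _; apply: contraNneq ne => ->.
move=> i; rewrite -(cards1 (g i)) subset_leq_card //; apply/subsetP => e.
rewrite !inE => /andP[/imsetP[j _ ->] gi].
apply: contraT => ne; have ji : j != i by apply: contraNneq ne => ->.
by have /disjointFr/(_ (f_in _ _ (gP j))) := hdisj _ _ ji; rewrite gi.
Qed.

(** * Real estimates for [N_eps] and the conclusion *)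

Lemma le_exp x y : (x <= y -> exp x <= exp y)%R.
Proof. by case=> [/exp_increasing|->]; lra. Qed.

Lemma exists_ceil_inv_le (x : R) : (0 < x)%R ->
  exists2 K : nat, 0 < K & (/ x <= INR K)%R /\ (INR K <= / x + 1)%R.
Proof.
move=> x0; have ix0 : (0 < / x)%R by apply: Rinv_0_lt_compat.
have [up1 up2] := archimed (/ x).
have up0 : (0 < up (/ x))%Z by apply: lt_IZR; apply: Rlt_trans up1.
exists (Z.to_nat (up (/ x))); first by lia.
by rewrite INR_IZR_INZ Z2Nat.id; [lra | lia].
Qed.

(** Since [ln eps <= eps], the power is at least [exp (-16)], and [exp 16 <= 3^16 < 10^8]. *)
Lemma N_eps_ge_1 (eps : R) : (1 <= eps -> 10 ^ 12 <= N_eps eps)%R.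
Proof.
move=> e1; have e0 : (0 < eps)%R by lra.
have ln_le : (ln eps <= eps)%R by have := exp_ineq1_le (ln eps); rewrite exp_ln //; lra.
have exp_ge : (exp (- 16) <= Rpower eps (- (16 / eps)))%R.
  rewrite /Rpower; apply: le_exp.
  have : (ln eps * / eps <= 1)%R.
    by apply: (Rmult_le_reg_r eps) => //; rewrite Rmult_assoc Rinv_l; lra.
  by rewrite /Rdiv; lra.
have exp16 : (exp 16 <= 3 ^ 16)%R.
  have -> : (exp 16 = exp 1 ^ 16)%R by rewrite -Rpower_pow ?Rpower_1 /Rpower ?ln_exp; [congr exp; simpl; lra | exact: exp_pos].
  by apply: pow_incr; split; [apply: Rlt_le; apply: exp_pos | apply: exp_le_3].
rewrite /N_eps; have : (/ 3 ^ 16 <= exp (- 16))%R.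
  by rewrite exp_Ropp; apply: Rinv_le_contravar => //; apply: exp_pos.
move=> H; apply: (Rle_trans _ (10 ^ 20 * / 3 ^ 16)); last by apply: Rmult_le_compat_l; lra.
by apply: (Rmult_le_reg_r (3 ^ 16)); [lra | rewrite Rmult_assoc Rinv_l; lra].
Qed.

Lemma N_eps_ge_inv_pow4 (eps : R) :
  (0 < eps < 1 -> 10 ^ 20 * (/ eps) ^ 4 <= N_eps eps)%R.
Proof.
move=> [e0 e1]; rewrite /N_eps; apply: Rmult_le_compat_l; first by lra.
have ie : (1 < / eps)%R by rewrite -Rinv_1; apply: Rinv_lt_contravar; lra.
rewrite -(Rpower_pow 4); last by lra.
have ln_neg : (ln eps < 0)%R by rewrite -ln_1; apply: ln_increasing.
rewrite /Rpower ln_Rinv //; apply: le_exp.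
rewrite /Rdiv (_ : INR 4 = 4%R); last by simpl; lra.
nra.
Qed.

Theorem mainTheorem1 (eps : R) (heps : (0 < eps)%R) (n : nat)
  (hn : (N_eps eps <= INR n)%R)
  (X Y : finType) (M : 'I_n -> {set X * Y})
  (hM : forall i : 'I_n, is_matching (M i))
  (hdisj : forall i j : 'I_n, i != j -> [disjoint M i & M j])
  (hsize : forall i : 'I_n, ((1 + eps) * INR n <= INR #|M i|)%R) :
  exists Rm : {set X * Y}, rainbow_matching M Rm /\ #|Rm| = n.
Proof.
(* [K] is 1 for [eps >= 1]; otherwise it is an integer between [1/eps] and [1/eps + 1 <= 2/eps]. The
   constant is [2^34 = 256 * (2^13)^2]. *)
have [K K0 [K_ge hK]] : exists2 K : nat, 0 < K &
    (1 <= INR K * eps /\ 2 ^ 34 * INR K ^ 4 <= INR n)%R.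
  have [e1|e1] := Rle_or_lt 1 eps.
    exists 1 => //; have := N_eps_ge_1 e1; rewrite /=; lra.
  have [K K0 [K_ge K_le]] := exists_ceil_inv_le heps; exists K => //.
  have ie : (1 < / eps)%R by rewrite -Rinv_1; apply: Rinv_lt_contravar; lra.
  split.
    by rewrite -(Rinv_l eps); [apply: Rmult_le_compat_r; lra | lra].
  apply: Rle_trans hn; apply: Rle_trans (N_eps_ge_inv_pow4 (conj heps e1)).
  have : (INR K ^ 4 <= (2 * / eps) ^ 4)%R.
    by apply: pow_incr; split; [apply: pos_INR | lra].
  by rewrite Rpow_mult_distr; have := pow_lt (/ eps) 4; lra.
have hn' : 256 * (2 ^ 13 * K ^ 2) ^ 2 <= n.
  apply/leP/INR_le; rewrite mult_INR.
  have INR_expn a b : INR (a ^ b) = (INR a ^ b)%R.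
    by elim: b => // b IHb; rewrite expnS mult_INR IHb.
  rewrite INR_expn mult_INR !INR_expn.
  have -> : INR 256 = 256%R := INR_IZR_INZ 256.
  by have -> : INR 2 = 2%R := INR_IZR_INZ 2; lra.
have hsize' i : n + n %/ K <= #|M i|.
  suff : K.+1 * n <= K * #|M i|.
    move=> H; rewrite -(leq_pmul2l K0); apply: leq_trans H.
    by have := leq_divM n K; nia.
  apply/leP/INR_le; rewrite !mult_INR S_INR; have := hsize i.
  have : (0 <= INR n)%R := pos_INR n; have : (0 <= INR K)%R := pos_INR K.
  nra.
(* The matchings are trimmed to a common size, since the upper tail bound needs an upper bound on
   them. *)
have /fin_all_exists[M1 M1P] : forall i, exists S : {set X * Y},
    S \subset M i /\ #|S| = n + n %/ K.
  by move=> i; have [S] := exists_subset_card (hsize' i); exists S.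
have [|i|i|f [[f_in f_dis] f_full]] := @nat_full_rainbow X Y 'I_n M1 K K0.
- by rewrite card_ord.
- by apply: is_matchingS (hM i); have [] := M1P i.
- by rewrite card_ord; have [] := M1P i.
apply: (rainbow_of_partial (f := f) hdisj) => //; split=> // i e /f_in.
by have [/subsetP sub _] := M1P i; apply: sub.
Qed.
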